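(* The symmetrized semi-relaxed Gromov-Hausdorff distance is equal to the modified Gromov-Hausdorff distance: for all metric spaces $X$ and $Y$, $$\widehat{d}_{\mathrm{srGH}}(X,Y)=d_{\mathrm{mGH}}(X,Y).$$
   Context: Let $X=(X,d_X)$ and $Y=(Y,d_Y)$ be metric spaces. All quantities below take values in $[0,\infty]$, with the conventions $\inf\emptyset=+\infty$ and $\sup\emptyset=0$. A relation $R\subset X\times Y$ is a semi-correspondence if the coordinate projection $X\times Y\to X$ maps $R$ onto $X$ (no condition on the projection to $Y$). $\mathcal{SR}(X,Y)$ denotes the set of semi-correspondences. The distortion of a relation is $$\mathrm{dis}(R)=\frac12\sup_{(x,y),(x',y')\in R}|d_X(x,x')-d_Y(y,y')|.$$ Define $d_{\mathrm{srGH}}(X,Y)=\inf_{R\in\mathcal{SR}(X,Y)}\mathrm{dis}(R)$ and $\widehat{d}_{\mathrm{srGH}}(X,Y)=\max\{d_{\mathrm{srGH}}(X,Y),d_{\mathrm{srGH}}(Y,X)\}$. For a (not necessarily continuous) function $f:X\to Y$, set $$\mathrm{dis}(f)=\frac12\sup_{x,x'\in X}|d_X(x,x')-d_Y(f(x),f(x'))|,$$ and similarly for $g:Y\to X$. The modified Gromov-Hausdorff distance is $$d_{\mathrm{mGH}}(X,Y)=\max\left\{\inf_{f:X\to Y}\mathrm{dis}(f),\ \inf_{g:Y\to X}\mathrm{dis}(g)\right\},$$ the infima being over all functions. *)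

(* Defs.v *)
From mathcomp Require Import all_boot all_order all_algebra.
From mathcomp Require Import classical_sets reals constructive_ereal ereal.
From mathcomp Require Import topology.

Set Implicit Arguments.
Unset Strict Implicit.
Unset Printing Implicit Defensive.

Import Order.TTheory GRing.Theory Num.Theory.

Local Open Scope classical_set_scope.
Local Open Scope ring_scope.
Local Open Scope ereal_scope.

(* Supremum in [0, +oo]: adding 0 only matters when S is empty, where it
   enforces sup set0 = 0 (the library has ereal_sup set0 = -oo).  For infima,
   ereal_inf set0 = +oo is already the wanted convention. *)
Definition nnsup (K : realType) (S : set (\bar K)) : \bar K :=
  ereal_sup (0 |` S).

(* metricType does not require a point, so X and Y may be empty. *)
Definition semicorrespondence (X Y : Type) (R : set (X * Y)) : Prop :=
  fst @` R = [set: X].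

Definition dis_rel (K : realType) (X Y : metricType K) (R : set (X * Y)) :
    \bar K :=
  (2^-1)%:E *
  nnsup [set `|mdist p.1 q.1 - mdist p.2 q.2|%R%:E | p in R & q in R].

Definition dis_fun (K : realType) (X Y : metricType K) (f : X -> Y) : \bar K :=
  (2^-1)%:E *
  nnsup [set `|mdist x x' - mdist (f x) (f x')|%R%:E
        | x in [set: X] & x' in [set: X]].

Definition d_srGH (K : realType) (X Y : metricType K) : \bar K :=
  ereal_inf [set dis_rel R | R in @semicorrespondence X Y].

Definition dhat_srGH (K : realType) (X Y : metricType K) : \bar K :=
  maxe (d_srGH X Y) (d_srGH Y X).

Definition d_mGH (K : realType) (X Y : metricType K) : \bar K :=
  maxe (ereal_inf [set dis_fun f | f in [set: X -> Y]])
       (ereal_inf [set dis_fun g | g in [set: Y -> X]]).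

(* Main.v *)
(* The graph of a function is a semi-correspondence of the same distortion;
   conversely, a choice function through a semi-correspondence has a graph
   contained in it, hence a distortion that is no larger. *)
Require Import Defs.
From mathcomp Require Import all_boot all_order all_algebra.
From mathcomp Require Import classical_sets reals constructive_ereal ereal.
From mathcomp Require Import topology.
From mathcomp Require boolp.

Import Order.TTheory GRing.Theory Num.Theory.
Local Open Scope classical_set_scope.
Local Open Scope ring_scope.
Local Open Scope ereal_scope.

Lemma le_nnsup (K : realType) (S T : set (\bar K)) :
  S `<=` T -> nnsup S <= nnsup T.
Proof. by move=> ST; apply: ereal_sup_le; apply: setUS. Qed.

Lemma le_dis_rel (K : realType) (X Y : metricType K) (R S : set (X * Y)) :
  R `<=` S -> dis_rel R <= dis_rel S.
Proof.
(* The factor 1/2 is positive and finite, so it cancels even when a supremum is infinite. *)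
move=> RS; rewrite /dis_rel lee_pmul2l ?lte_fin ?invr_gt0 ?ltr0n //.
apply: le_nnsup => _ [p Rp [q Rq <-]].
by exists p; [exact: RS|exists q => //; exact: RS].
Qed.

(** Points of the graph are parametrized by [X], so both suprema run over the same set of values. *)
Lemma dis_rel_graph (K : realType) (X Y : metricType K) (f : X -> Y) :
  dis_rel [set (x, f x) | x in [set: X]] = dis_fun f.
Proof.
rewrite /dis_rel /dis_fun; congr (_ * nnsup _); apply/seteqP; split.
  by move=> _ [_ [x _ <-]] [_ [x' _ <-]] <-; exists x => //; exists x'.
move=> _ [x _ [x' _ <-]].
by exists (x, f x); [exists x|exists (x', f x') => //; exists x'].
Qed.

Lemma semicorrespondence_graph (X Y : Type) (f : X -> Y) :
  semicorrespondence [set (x, f x) | x in [set: X]].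
Proof.
by apply/seteqP; split=> // x _; exists (x, f x) => //; exists x.
Qed.

(** Surjectivity onto [X] makes every fibre of [R] over [X] nonempty, and the axiom of choice picks
    a point in each. If [Y] is empty, then so is [X], and [f] is the empty function. *)
Lemma semicorrespondence_selection (X Y : Type) (R : set (X * Y)) :
  semicorrespondence R ->
  exists f : X -> Y, [set (x, f x) | x in [set: X]] `<=` R.
Proof.
move=> RX; have Rtot x : exists y, R (x, y).
  have : [set: X] x by [].
  by rewrite -RX => -[[x' y] Rxy /= <-]; exists y.
have [f fR] := boolp.choice Rtot.
by exists f => _ [x _ <-]; exact: fR.
Qed.

(** Applied to both orders of the spaces, this matches the two maxima term by term. *)
Lemma d_srGH_inf_dis_fun (K : realType) (X Y : metricType K) :
  d_srGH X Y = ereal_inf [set dis_fun f | f in [set: X -> Y]].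
Proof.
apply/eqP; rewrite eq_le; apply/andP; split.
  (* Graphs are among the relations on the left, so that infimum is over a larger set of values. *)
  apply: ereal_inf_le_tmp => _ [f _ <-].
  exists [set (x, f x) | x in [set: X]]; last exact: dis_rel_graph.
  exact: semicorrespondence_graph.
apply: le_ereal_inf_tmp => _ [R /semicorrespondence_selection[f fR] <-].
(* The distortion of the graph of [f] is the intermediate term. *)
apply: le_trans (le_dis_rel _ _ _ _ _ fR).
by rewrite dis_rel_graph; apply: ereal_inf_lbound; exists f.
Qed.

Theorem theorem8 (K : realType) (X Y : metricType K) :
  dhat_srGH X Y = d_mGH X Y.
Proof. by rewrite /dhat_srGH /d_mGH !d_srGH_inf_dis_fun. Qed.
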